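(* For any prime $p>3$ and integer $r>0$, we have $$\sum_{n=0}^{p^r-1}\frac{3n+1}{(-8)^n}\binom{2n}{n}^3\equiv(-1)^{(p^r-1)/2}p^r\pmod{p^{r+2}}.$$
   Context: Congruences are between rational numbers whose denominators are prime to $p$: $a\equiv b\pmod{p^m}$ means that $(a-b)/p^m$ is a rational number with denominator prime to $p$. *)

(* Defs.v *)
From mathcomp Require Import all_boot all_order all_algebra.

Set Implicit Arguments.
Unset Strict Implicit.
Unset Printing Implicit Defensive.

Local Open Scope ring_scope.

Definition p_integral (p : nat) (x : rat) : bool := coprime p `|denq x|%N.

(* The modulus is p ^ m, given by p and the exponent m.  The prime has to be a
   separate argument: the denominator condition is about p, also when m = 0. *)
Definition rat_congr (p m : nat) (a b : rat) : bool :=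
  p_integral p ((a - b) / p%:R ^+ m).

(* Main.v *)
Require Import Defs.
From mathcomp Require Import all_boot all_order all_algebra all_field.
From mathcomp Require Import ring zify.
Import Order.TTheory GRing.Theory Num.Theory.

Local Open Scope ring_scope.

(** The congruence is the value at q = 1 of a divisibility in Z[q].  Write
    (a;q)_k for the product of the 1 - a q^i over i < k, (a, b, c; q)_k for
    (a;q)_k (b;q)_k (c;q)_k, [n] for the q-integer 1 + q + ... + q^(n-1), and
    N = p^r = 2m + 1.  Since
    (q;q^2)_k / (q;q)_k is the q-analogue of 'C(2k, k) divided by
    (1 + q) ... (1 + q^k), which is 2^k at q = 1, the polynomial [full_defect m],
    namely the difference
      sum_(k < N) (-1)^k [3k+1] ((q;q^2)_k / (q;q)_k)^3 - (-1)^m q^(m^2) [N]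
    multiplied by the cube of (1 + q) ... (1 + q^(N-1)), equals at q = 1 the
    difference of the two sides of the congruence multiplied by 8^(N-1).  It is
    divisible in Z[q] by [N] Phi_N(q)^2 (lemma [full_defect_dvd]); as [N] is p^r
    at q = 1 and Phi_N is p there, p^(r+2) divides the value.

    The source of the divisibility is a summation formula with a parameter a
    (lemma [wz_sum]): for a odd, a = 2M + 1,
      sum_(k <= M) (-1)^k (1 - q^(3k+1)) (q, q^(1+a), q^(1-a); q^2)_k
                   / (q, q^(1+a), q^(1-a); q)_k = (-1)^M q^(M^2) (1 - q^a),
    proved by the Wilf-Zeilberger method: its summand for a + 2, suitably
    normalized, differs from that for a by a difference in k
    (lemma [wz_partial]).

    The factors come in pairs, and
    (1 - q^(j+a)) (1 - q^(j-a)) = (1 - q^j)^2 - q^j b, b = q^a + q^(-a) - 2,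
    so that after clearing denominators the sum over k <= m is a polynomial in
    b of degree at most m.  For a = N the formula gives its value at
    b = (1 - q^N)^2 / q^N, while the truncation of the sum of the theorem is
    its value at b = 0.  When q is a primitive N-th root of unity z, the formula
    for a = 1, 3, ..., N shows that the polynomial has m + 1 distinct roots b,
    hence is zero (lemma [cleared_sum_deform]): Phi_N divides all its
    coefficients.  As b = 0 and b = (1 - q^N)^2 / q^N differ by a multiple of
    Phi_N^2, the two values agree modulo Phi_N^3 (lemma
    [PhiC_cube_half_defect]).  The terms with m < k < N are divisible by Phi_N^3.

    For the remaining part of [N], let z be a primitive d-th root of unity, where
    d > 1 divides N.  The term of index l d + i is, at z, a constant depending
    on l times the term of index i, so the sum is cut into blocks of length d
    proportional to the first one, which vanishes by the formula for
    a = d (lemma [full_defect_root]). *)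

(** * A terminating q-series identity, by the Wilf-Zeilberger method *)

(** The factor of index [j] in the summation formula, with [A] in the role of
    q^a: up to the power of q given by [A], it is
    (1 - q^j) (1 - q^(j+a)) (1 - q^(j-a)).  Multiplying by [A] keeps it
    polynomial in [q] and [A], and does not change quotients of factors. *)
Definition wz_factor {R : pzRingType} (q A : R) (j : nat) : R :=
  (1 - q ^+ j) * (1 - q ^+ j * A) * (A - q ^+ j).

(** The quotient (q, q^(1+a), q^(1-a); q^2)_k / (q, q^(1+a), q^(1-a); q)_k. *)
Definition wz_prod {F : fieldType} (q A : F) (k : nat) : F :=
  \prod_(i < k) (wz_factor q A (2 * i + 1) / wz_factor q A (i + 1)).

(** The summand of the formula, with A in the role of q^a. *)
Definition wz_term {F : fieldType} (q A : F) (k : nat) : F :=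
  (-1) ^+ k * (1 - q ^+ (3 * k + 1)) * wz_prod q A k.

Lemma wz_prodS (F : fieldType) (q A : F) k :
  wz_prod q A k.+1 =
  wz_prod q A k * (wz_factor q A (2 * k + 1) / wz_factor q A (k + 1)).
Proof. by rewrite /wz_prod big_ord_recr. Qed.

Section WZ.
Variables (F : fieldType) (q : F).
Hypothesis q_neq0 : q != 0.
Hypothesis q_nroot : forall j, (0 < j)%N -> 1 - q ^+ j != 0.

Section Shift.
Variables (A : F) (M : nat).
Hypothesis A_neq0 : A != 0.
(* These two assumptions hold for [A = q ^+ (2 * M + 1)], the only case of
   interest; they make all denominators below nonzero. *)
Hypothesis A_gt1 : forall j, 1 - q ^+ j * A != 0.
Hypothesis A_gt : forall i j, (j <= i + 2 * M)%N -> q ^+ i * A - q ^+ j != 0.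

(** The effect on the product of replacing a by a + 2. *)
Lemma wz_shift k : (k <= M)%N ->
  wz_prod q (A * q ^+ 2) k = wz_prod q A k *
    ((1 - q * A * q ^+ k ^+ 2) * (1 - q ^+ 2 * A) * (A - q ^+ k) * (q * A - q ^+ k)) /
    ((q * A - q ^+ k ^+ 2) * (1 - q * q ^+ k * A) * (1 - q ^+ 2 * q ^+ k * A) * (A - 1)).
Proof using q_neq0 q_nroot A_neq0 A_gt1 A_gt.
have h4 : A - 1 != 0 by have := A_gt 0 0 isT; rewrite expr0 mul1r.
elim: k => [|k IH] leM /=.
  have h1 : q * A - 1 != 0 by have := A_gt 1 0 isT; rewrite expr1.
  have h2 : 1 - q * A != 0 by have := A_gt1 1; rewrite expr1.
  have h3 : 1 - q ^+ 2 * A != 0 by [].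
  rewrite /wz_prod !big_ord0 expr0.
  field.
  by rewrite h4 h3 h2 h1.
have {}IH := IH (ltnW leM); rewrite /= in IH.
have g1 : q * A - q ^+ k ^+ 2 != 0.
  by have := A_gt 1 (k * 2); rewrite expr1 exprM; apply; lia.
have g2 : q * A - (q * q ^+ k) ^+ 2 != 0.
  by have := A_gt 1 (k.+1 * 2); rewrite expr1 exprM (exprS q k); apply; lia.
have g3 : 1 - q * q ^+ k * A != 0 by rewrite -exprS.
have g4 : 1 - q ^+ 2 * q ^+ k * A != 0 by rewrite -exprD.
have g5 : 1 - q ^+ 3 * q ^+ k * A != 0 by rewrite -exprD.
have g6 : 1 - q * q ^+ k != 0 by rewrite -exprS q_nroot.
have g7 : A - q * q ^+ k != 0.
  by have := A_gt 0 k.+1; rewrite expr0 mul1r exprS; apply; lia.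
have g8 : q * A - q ^+ k != 0.
  by have := A_gt 1 k; rewrite expr1; apply; lia.
rewrite !wz_prodS IH /wz_factor.
rewrite !addn1 !exprS mul2n -addnn exprD expr0 mulr1.
move: (q ^+ k) g1 g2 g3 g4 g5 g6 g7 g8 => Q g1 g2 g3 g4 g5 g6 g7 g8.
field.
have g9 : 1 - q * (q * Q) * A != 0 by rewrite mulrA.
have g10 : 1 - q * q * (q * Q) * A != 0.
  by rewrite (_ : q * q * (q * Q) = q ^+ 3 * Q) //; ring.
have g11 : A * (q * q) - q * Q != 0.
  by rewrite (_ : _ - _ = q * (q * A - Q)) ?mulf_neq0 //; ring.
by rewrite !(g1, g2, g3, g4, g5, g6, g7, g8, g9, g10, g11) h4.
Qed.

(** Summed form of the Wilf-Zeilberger equation: the right-hand side is the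
    rational certificate, a multiple of [wz_prod]. *)
Lemma wz_partial K : (K <= M)%N ->
  (1 - A) * (\sum_(k < K.+1) wz_term q (A * q ^+ 2) k)
    + A * (1 - A * q ^+ 2) * (\sum_(k < K.+1) wz_term q A k)
  = (1 - A * q ^+ 2) * (-1) ^+ K * (1 - A ^+ 2 * q ^+ 2) * q ^+ K
    * (1 - q * q ^+ K ^+ 2) * (1 - q * q ^+ K ^+ 2 * A)
    / ((1 - q * q ^+ K * A) * (1 - q ^+ 2 * q ^+ K * A)) * wz_prod q A K.
Proof using q_neq0 q_nroot A_neq0 A_gt1 A_gt.
have h4 : A - 1 != 0 by have := A_gt 0 0 isT; rewrite expr0 mul1r.
elim: K => [|K IH] leM.
  have h2 : 1 - q * A != 0 by have := A_gt1 1; rewrite expr1.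
  have h3 : 1 - q ^+ 2 * A != 0 by [].
  rewrite !big_ord1 /wz_term /wz_prod !big_ord0 !expr0 muln0 add0n expr1.
  by field; rewrite h2 h3.
rewrite 2!(big_ord_recr K.+1) /= (mulrDr (1 - A)) (mulrDr (A * _)) addrACA.
rewrite (IH (ltnW leM)).
rewrite /wz_term wz_shift // wz_prodS /wz_factor.
have g1 : q * A - q ^+ K ^+ 2 != 0.
  by have := A_gt 1 (K * 2); rewrite expr1 exprM; apply; lia.
have g2 : q * A - (q * q ^+ K) ^+ 2 != 0.
  by have := A_gt 1 (K.+1 * 2); rewrite expr1 exprM (exprS q K); apply; lia.
have g3 : 1 - q * q ^+ K * A != 0 by rewrite -exprS.
have g4 : 1 - q ^+ 2 * q ^+ K * A != 0 by rewrite -exprD.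
have g5 : 1 - q ^+ 3 * q ^+ K * A != 0 by rewrite -exprD.
have g6 : 1 - q * q ^+ K != 0 by rewrite -exprS q_nroot.
have g7 : A - q * q ^+ K != 0.
  by have := A_gt 0 K.+1; rewrite expr0 mul1r exprS; apply; lia.
have -> : q ^+ (3 * K.+1 + 1) = q ^+ 4 * q ^+ K ^+ 3.
  by rewrite -exprM -exprD; congr (_ ^+ _); lia.
have -> : q ^+ (2 * K + 1) = q * q ^+ K ^+ 2.
  by rewrite -exprM -exprS; congr (_ ^+ _); lia.
rewrite addn1 (exprS q K) (exprS (-1) K).
move: (q ^+ K) g1 g2 g3 g4 g5 g6 g7 => Q g1 g2 g3 g4 g5 g6 g7.
field.
have g8 : 1 - q * (q * Q) * A != 0 by rewrite mulrA.
have g9 : 1 - q ^+ 2 * (q * Q) * A != 0.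
  by rewrite (_ : q ^+ 2 * (q * Q) = q ^+ 3 * Q) //; ring.
by rewrite !(g1, g2, g3, g4, g5, g6, g7, g8, g9) h4.
Qed.

End Shift.
End WZ.

(** The summation formula, by induction on [M]: the added last term of the sum
    for M + 1 cancels the boundary term of [wz_partial]. *)
Lemma wz_sum (F : fieldType) (q : F) (M : nat) :
  q != 0 -> (forall j, (0 < j)%N -> 1 - q ^+ j != 0) ->
  \sum_(k < M.+1) wz_term q (q ^+ (2 * M + 1)) k
  = (-1) ^+ M * q ^+ (M ^ 2) * (1 - q ^+ (2 * M + 1)).
Proof.
move=> q0 q1; elim: M => [|M IH].
  rewrite big_ord1 /wz_term /wz_prod big_ord0 exp0n // !muln0 !add0n !expr0.
  by rewrite !mul1r mulr1.
have A0 : q ^+ (2 * M + 1) != 0 by rewrite expf_neq0.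
have A1 j : 1 - q ^+ j * q ^+ (2 * M + 1) != 0 by rewrite -exprD q1 // addn1 addnS.
have A2 i j : (j <= i + 2 * M)%N -> q ^+ i * q ^+ (2 * M + 1) - q ^+ j != 0.
  move=> le; rewrite -exprD -(subnK (_ : j <= i + (2 * M + 1)))%N; last by lia.
  rewrite exprD -{2}[q ^+ j]mul1r -mulrBl mulf_neq0 ?expf_neq0 //.
  by rewrite -opprB oppr_eq0 q1 //; lia.
have A3 : 1 - q ^+ (2 * M + 1) != 0 by rewrite q1 // addn1.
have := wz_partial F q q0 q1 _ M A0 A1 A2 M (leqnn M).
rewrite IH => /(canRL (addrK _)) E.
apply: (mulfI A3); rewrite big_ord_recr /= mulrDr.
rewrite (_ : q ^+ (2 * M.+1 + 1) = q ^+ (2 * M + 1) * q ^+ 2); last first.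
  by rewrite -exprD; congr (_ ^+ _); lia.
rewrite E /wz_term wz_prodS (wz_shift F q q0 q1 _ M A0 A1 A2 M (leqnn M)) /wz_factor.
have h1 : 1 - q * q ^+ M != 0 by rewrite -exprS q1.
have h2 : 1 - q * q ^+ M * q ^+ (2 * M + 1) != 0 by rewrite -exprS.
have h3 : 1 - q ^+ 2 * q ^+ M * q ^+ (2 * M + 1) != 0 by rewrite -exprD.
have h4 : 1 - q ^+ 3 * q ^+ M * q ^+ (2 * M + 1) != 0 by rewrite -exprD.
have h5 : q * q ^+ (2 * M + 1) - q ^+ M ^+ 2 != 0.
  by have := A2 1 (M * 2); rewrite expr1 exprM; apply; lia.
have h6 : q ^+ (2 * M + 1) - 1 != 0 by rewrite -opprB oppr_eq0.
have h7 : q * q ^+ (2 * M + 1) - q ^+ M != 0.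
  by have := A2 1 M; rewrite expr1; apply; lia.
have -> : q ^+ (M.+1 ^ 2) = q ^+ (M ^ 2) * q ^+ (2 * M + 1).
  by rewrite -exprD; congr (_ ^+ _); rewrite !expnS !expn0; lia.
have -> : q ^+ (3 * M.+1 + 1) = q ^+ 4 * q ^+ M ^+ 3.
  by rewrite -exprM -exprD; congr (_ ^+ _); lia.
have EA : q ^+ (2 * M + 1) = q * q ^+ M ^+ 2.
  by rewrite -exprM -exprS; congr (_ ^+ _); lia.
rewrite EA in h2 h3 h4 h5 h6 h7 *.
rewrite addn1 (exprS q M) (exprS (-1) M).
have := expf_neq0 M q0.
move: (q ^+ (M ^ 2)) (q ^+ M) h1 h2 h3 h4 h5 h6 h7.
move=> P Q h1 h2 h3 h4 h5 h6 h7 Q0.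
field.
have g1 : q * Q ^+ 2 * q ^+ 2 - q * Q != 0.
  by rewrite (_ : _ - _ = q * (q * (q * Q ^+ 2) - Q)) ?mulf_neq0 //; ring.
have g2 : 1 - q * Q * (q * Q ^+ 2 * q ^+ 2) != 0.
  by rewrite (_ : q * Q * _ = q ^+ 3 * Q * (q * Q ^+ 2)) //; ring.
by rewrite g1 g2 h1 h2 h3 h5 h6.
Qed.

(** * Clearing denominators *)

(** The sum over k <= m of the terms
    (-1)^k (1 - q^(3k+1)) w_1 w_3 ... w_(2k-1) / (w_1 w_2 ... w_k), multiplied by
    the common denominator w_1 ... w_m. *)
Definition cleared_sum {R : pzRingType} (q : R) (w : nat -> R) (m : nat) : R :=
  \sum_(k < m.+1) (-1) ^+ k * (1 - q ^+ (3 * k + 1)) *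
    ((\prod_(i < k) w (2 * i + 1)%N) * \prod_(k <= j < m) w j.+1).

Lemma cleared_sum_morph (R S : pzRingType) (f : {rmorphism R -> S}) q w m :
  f (cleared_sum q w m) = cleared_sum (f q) (f \o w) m.
Proof.
rewrite rmorph_sum; apply: eq_bigr => k _.
by rewrite !rmorphM rmorphB !rmorphXn rmorphN rmorph1 !rmorph_prod.
Qed.

Lemma eq_cleared_sum {R : pzRingType} {q : R} {w1 w2 m} :
  w1 =1 w2 -> cleared_sum q w1 m = cleared_sum q w2 m.
Proof.
move=> e; apply: eq_bigr => k _; congr (_ * (_ * _)).
  by apply: eq_bigr.
by apply: eq_bigr.
Qed.

Lemma cleared_sumZ (R : comPzRingType) (q c : R) w m :
  cleared_sum q (fun j => c * w j) m = c ^+ m * cleared_sum q w m.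
Proof.
rewrite /cleared_sum mulr_sumr; apply: eq_bigr => k _.
rewrite !big_split /= prodr_const card_ord prodr_const_nat.
have -> : c ^+ m = c ^+ k * c ^+ (m - k) by rewrite -exprD subnKC // -ltnS.
ring.
Qed.

Lemma cleared_sum_generic (F : fieldType) (q : F) (m M : nat) :
  q != 0 -> (forall j, (0 < j)%N -> 1 - q ^+ j != 0) -> (M <= m)%N ->
  let w := wz_factor q (q ^+ (2 * M + 1)) in
  cleared_sum q w m
  = (-1) ^+ M * q ^+ (M ^ 2) * (1 - q ^+ (2 * M + 1)) * \prod_(0 <= j < m) w j.+1.
Proof.
move=> q0 q1 leM w; rewrite -wz_sum // /cleared_sum.
rewrite -(big_mkord xpredT (fun k => (-1) ^+ k * (1 - q ^+ (3 * k + 1)) *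
    ((\prod_(i < k) w (2 * i + 1)%N) * \prod_(k <= j < m) w j.+1))).
(* The terms with k > M vanish, because they contain the factor w_(2M+1). *)
rewrite (big_cat_nat (n := M.+1)) //= addrC big1_seq ?add0r; last first.
  move=> k; rewrite mem_index_iota => /andP[_ /andP[lMk lkm]].
  rewrite (bigD1 (Ordinal lMk)) //= {1}/w /wz_factor subrr mulr0.
  by rewrite !(mul0r, mulr0).
rewrite big_mkord mulr_suml; apply: eq_bigr => k _.
rewrite /wz_term -[RHS]mulrA; congr (_ * _).
have lekM : (k <= M)%N by rewrite -ltnS.
rewrite (big_cat_nat (m := 0) (n := k) (p := m)) ?(leq_trans lekM) //= mulrA; congr (_ * _).
rewrite /wz_prod -(big_mkord xpredT (fun i => w (2 * i + 1)%N)).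
rewrite -(big_mkord xpredT (fun i => wz_factor q _ (2 * i + 1) / wz_factor q _ (i + 1))).
rewrite -big_split /= big_seq [RHS]big_seq; apply: eq_bigr => i.
rewrite mem_index_iota => /andP[_ ltik].
rewrite (addn1 i) divfK // /w /wz_factor.
rewrite !mulf_neq0 ?q1 // -?exprD ?q1 //.
rewrite -(subnK (_ : i.+1 <= 2 * M + 1))%N; last by lia.
rewrite exprD -[X in _ - X]mul1r -mulrBl mulf_neq0 ?expf_neq0 //.
by rewrite -opprB oppr_eq0 q1 //; lia.
Qed.

Lemma algC_nat_nroot (k j : nat) : (0 < j)%N -> 1 - (k.+2%:R : algC) ^+ j != 0.
Proof.
move=> j0; rewrite -natrX subr_eq0 eq_sym (eqr_nat _ _ 1).
by rewrite -[1%N](exp1n j) eqn_exp2r.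
Qed.

(* A polynomial vanishing at every integer at least 2 is zero. *)
Lemma poly_eq0_nat (p : {poly algC}) : (forall k : nat, p.[k.+2%:R] = 0) -> p = 0.
Proof.
move=> p0; pose rs := [seq k.+2%:R : algC | k <- iota 0 (size p)].
apply: (@roots_geq_poly_eq0 _ p rs).
- by apply/allP => x /mapP[k _ ->]; apply/rootP.
- rewrite map_inj_uniq ?iota_uniq // => i j /eqP.
  by rewrite eqr_nat => /eqP[].
- by rewrite size_map size_iota.
Qed.

Lemma wz_factor_morph (R S : pzRingType) (f : {rmorphism R -> S}) q A j :
  f (wz_factor q A j) = wz_factor (f q) (f A) j.
Proof. by rewrite !rmorphM !rmorphB rmorph1 !rmorphM !rmorphXn. Qed.

(** The summation formula as an identity of polynomials in q.  In contrast with
    [cleared_sum_generic], it may be specialized at roots of unity. *)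
Lemma cleared_sum_poly (m M : nat) : (M <= m)%N ->
  let w := wz_factor ('X : {poly algC}) ('X ^+ (2 * M + 1)) in
  cleared_sum 'X w m
  = (-1) ^+ M * 'X ^+ (M ^ 2) * (1 - 'X ^+ (2 * M + 1)) * \prod_(0 <= j < m) w j.+1.
Proof.
move=> leM w; apply/eqP; rewrite -subr_eq0; apply/eqP; apply: poly_eq0_nat => k.
pose x : algC := k.+2%:R; rewrite -/x.
rewrite -[_.[x]]/(horner_eval x _) rmorphB cleared_sum_morph.
rewrite !rmorphM rmorphB rmorph1 !rmorphXn rmorphN rmorph1 rmorph_prod.
rewrite /= /horner_eval hornerX.
have x0 : x != 0 by rewrite pnatr_eq0.
have ew j : (w j).[x] = wz_factor x (x ^+ (2 * M + 1)) j.
  by rewrite -[LHS]/(horner_eval x _) wz_factor_morph rmorphXn /= /horner_eval hornerX.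
rewrite (eq_cleared_sum ew) cleared_sum_generic //; last exact: algC_nat_nroot.
by under [in X in _ - X]eq_bigr do rewrite ew; rewrite subrr.
Qed.

Lemma cleared_sum_algC (z : algC) (m M : nat) : (M <= m)%N ->
  let w := wz_factor z (z ^+ (2 * M + 1)) in
  cleared_sum z w m
  = (-1) ^+ M * z ^+ (M ^ 2) * (1 - z ^+ (2 * M + 1)) * \prod_(0 <= j < m) w j.+1.
Proof.
move=> leM w; have /(congr1 (horner_eval z)) := cleared_sum_poly m M leM.
rewrite cleared_sum_morph.
rewrite !rmorphM rmorphB rmorph1 !rmorphXn rmorphN rmorph1 rmorph_prod.
rewrite /= /horner_eval hornerX => E.
have ew j : (wz_factor ('X : {poly algC}) ('X ^+ (2 * M + 1)) j).[z] = w j.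
  by rewrite -[LHS]/(horner_eval z _) wz_factor_morph rmorphXn /= /horner_eval hornerX.
rewrite -(eq_cleared_sum ew) E; congr (_ * _).
by apply: eq_bigr.
Qed.

(** At a primitive N-th root of unity the right-hand side of the formula is
    zero for every odd a <= N: one of a = N, a <= m and N - a <= m holds, and
    in the last two cases a factor of the common denominator vanishes. *)
Lemma cleared_sum_root (z : algC) (m M : nat) :
  (2 * m + 1).-primitive_root z -> (M <= m)%N ->
  cleared_sum z (wz_factor z (z ^+ (2 * M + 1))) m = 0.
Proof.
move=> zn leM; rewrite cleared_sum_algC //.
have [->|neM] := eqVneq M m; first by rewrite (prim_expr_order zn) subrr mulr0 mul0r.
have [lt|le] := ltnP (2 * M) m.
  rewrite (bigD1_seq (2 * M)%N) ?mem_index_iota ?iota_uniq //= /wz_factor.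
  by rewrite addn1 subrr !(mulr0, mul0r).
rewrite (bigD1_seq (2 * m - 2 * M).-1) ?mem_index_iota ?iota_uniq //=; last by lia.
rewrite /wz_factor -exprD.
have -> : ((2 * m - 2 * M).-1.+1 + (2 * M + 1) = 2 * m + 1)%N by lia.
by rewrite (prim_expr_order zn) subrr !(mulr0, mul0r).
Qed.

(** * Divisibility by the cube of a cyclotomic polynomial *)

(** The cyclotomic polynomial with coefficients in the algebraic numbers. *)
Definition PhiC (n : nat) : {poly algC} := map_poly intr 'Phi_n.

Lemma root_PhiC n (z : algC) : (0 < n)%N -> root (PhiC n) z = n.-primitive_root z.
Proof.
move=> n0; have [x xn] := C_prim_root_exists n0.
by rewrite /PhiC (Cintr_Cyclotomic xn) root_cyclotomic.
Qed.

Lemma separable_dvdp (p f : {poly algC}) :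
  separable_poly p -> (forall z, root p z -> root f z) -> p %| f.
Proof.
move=> sep_p pf; have [rs defp] := closed_field_poly_normal p.
have p0 : p != 0 by apply: separable_poly_neq0.
have l0 : lead_coef p != 0 by rewrite lead_coef_eq0.
rewrite defp dvdpZl //; apply: uniq_roots_dvdp.
  apply/allP=> z zrs; apply: pf; rewrite defp rootZ //.
  by rewrite root_prod_XsubC.
rewrite uniq_rootsE -separable_prod_XsubC.
by move: sep_p; rewrite {1}defp; apply: dvdp_separable; rewrite dvdpZr // dvdpp.
Qed.

Lemma PhiC_dvd n (f : {poly algC}) : (0 < n)%N ->
  (forall z, n.-primitive_root z -> root f z) -> PhiC n %| f.
Proof.
move=> n0 h; apply: separable_dvdp => [|z]; last by rewrite root_PhiC //; apply: h.
have: separable_poly ('X^n - 1 : {poly algC}).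
  by rewrite separable_Xn_sub_1 // pnatr_eq0 -lt0n.
apply: dvdp_separable; have [x xn] := C_prim_root_exists n0.
rewrite (prod_cyclotomic xn) (big_rem n) /=; last by rewrite -dvdn_divisors.
by rewrite divnn n0 expr1 -(Cintr_Cyclotomic xn) dvdp_mulr.
Qed.

Lemma size_prod_affine (R : nzRingType) (I : Type) (r : seq I) (w : I -> {poly R}) :
  (forall i, size (w i) <= 2)%N -> (size (\prod_(i <- r) w i)%R <= (size r).+1)%N.
Proof.
move=> hw; elim: r => [|i r IH]; first by rewrite big_nil size_poly1.
rewrite big_cons; apply: (leq_trans (size_polyMleq _ _)).
have := hw i; move: IH => /=; lia.
Qed.

Lemma size_cleared_sum (R : nzRingType) (c : R) (w : nat -> {poly R}) m :
  (forall j, size (w j) <= 2)%N -> (size (cleared_sum c%:P w m) <= m.+1)%N.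
Proof.
move=> hw; apply: (leq_trans (size_sum _ _ _)); apply/bigmax_leqP => k _.
have -> : (-1) ^+ k * (1 - c%:P ^+ (3 * k + 1))
    = ((-1) ^+ k * (1 - c ^+ (3 * k + 1)))%:P :> {poly R}.
  by rewrite rmorphM rmorphB !rmorphXn rmorphN rmorph1.
rewrite mul_polyC; apply: (leq_trans (size_scale_leq _ _)).
rewrite -(big_mkord xpredT (fun i => w (2 * i + 1)%N)).
apply: (leq_trans (size_polyMleq _ _)).
have /= := size_prod_affine R _ (index_iota 0 k) (fun i => w (2 * i + 1)%N) (fun i => hw _).
have /= := size_prod_affine R _ (index_iota k m) (fun i => w i.+1) (fun i => hw _).
rewrite !size_iota subn0 => hb ha; have lkm : (k <= m)%N by rewrite -ltnS.
apply: (leq_trans (n := (k.+1 + (m - k).+1).-1)); last by rewrite addSn addnS subnKC.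
by rewrite -!subn1 leq_sub2r // leq_add.
Qed.

Lemma prim_root_neq0 {n : nat} {z : algC} : n.-primitive_root z -> z != 0.
Proof.
move=> zn; apply/eqP => z0; have /eqP := prim_expr_order zn.
by rewrite z0 expr0n gtn_eqF ?(prim_order_gt0 zn) // eq_sym oner_eq0.
Qed.

(** The values b = (1 - z^a)^2 / z^a for a = 1, 3, ..., 2m + 1 are distinct. *)
Lemma root_param_inj (z : algC) m M1 M2 :
  (2 * m + 1).-primitive_root z -> (M1 <= m)%N -> (M2 <= m)%N ->
  (1 - z ^+ (2 * M1 + 1)) ^+ 2 / z ^+ (2 * M1 + 1)
    = (1 - z ^+ (2 * M2 + 1)) ^+ 2 / z ^+ (2 * M2 + 1) -> M1 = M2.
Proof.
move=> zn le1 le2.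
have z0 := prim_root_neq0 zn.
have a0 : z ^+ (2 * M1 + 1) != 0 by rewrite expf_neq0.
have b0 : z ^+ (2 * M2 + 1) != 0 by rewrite expf_neq0.
move=> /eqP; rewrite eqr_div // => /eqP e.
have /eqP : (z ^+ (2 * M1 + 1) - z ^+ (2 * M2 + 1))
    * (z ^+ (2 * M1 + 1) * z ^+ (2 * M2 + 1) - 1) = 0.
  move/eqP: e; rewrite -subr_eq0 => /eqP <-; ring.
rewrite mulf_eq0 !subr_eq0 -exprD => /orP[].
  rewrite (eq_prim_root_expr zn) => /eqP.
  have [->|n1] := eqVneq M1 m.
    rewrite modnn; have [->//|n2] := eqVneq M2 m.
    by rewrite modn_small; lia.
  rewrite modn_small; last by lia.
  have [->|n2] := eqVneq M2 m; first by rewrite modnn; lia.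
  rewrite modn_small; lia.
rewrite -(prim_order_dvd zn).
have -> : (2 * M1 + 1 + (2 * M2 + 1) = 2 * (M1 + M2 + 1))%N by lia.
rewrite Gauss_dvdr; last by rewrite coprime_sym coprime2n addn1 /= mul2n odd_double.
by move/dvdn_leq; lia.
Qed.

(** The factor of index [j] as an affine polynomial in the parameter b:
    (1 - q^j) ((1 - q^j)^2 U - q^j b).  For U = q^a and b = (1 - q^a)^2 it is
    [wz_factor q (q ^+ a) j]; the factor U avoids dividing b by q^a. *)
Definition wz_deform {R : comNzRingType} (q U : R) (j : nat) : {poly R} :=
  ((1 - q ^+ j) ^+ 3 * U)%:P - ((1 - q ^+ j) * q ^+ j)%:P * 'X.

Lemma wz_deform_horner (R : comNzRingType) (q U v : R) j :
  (wz_deform q U j).[v] = (1 - q ^+ j) ^+ 3 * U - (1 - q ^+ j) * q ^+ j * v.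
Proof. by rewrite !hornerE. Qed.

Lemma size_wz_deform (R : comNzRingType) (q U : R) j : (size (wz_deform q U j) <= 2)%N.
Proof.
apply: (leq_trans (size_polyD _ _)); rewrite geq_max size_polyN.
rewrite (leq_trans (size_polyC_leq1 _)) //= mul_polyC.
by rewrite (leq_trans (size_scale_leq _ _)) // size_polyX.
Qed.

(** A polynomial of degree at most m in b, with m + 1 roots. *)
Lemma cleared_sum_deform (z : algC) m :
  (2 * m + 1).-primitive_root z -> cleared_sum z%:P (wz_deform z 1) m = 0.
Proof.
move=> zn; have z0 := prim_root_neq0 zn.
pose b M := (1 - z ^+ (2 * M + 1)) ^+ 2 / z ^+ (2 * M + 1).
apply: (@roots_geq_poly_eq0 _ _ [seq b M | M <- iota 0 m.+1]).
- apply/allP => y /mapP[M]; rewrite mem_iota => /andP[_ ltM] ->.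
  apply/rootP; rewrite -[_.[_]]/(horner_eval (b M) _) cleared_sum_morph.
  rewrite /= /horner_eval hornerC.
  have aM : z ^+ (2 * M + 1) != 0 by rewrite expf_neq0.
  apply: (mulfI (expf_neq0 m aM)); rewrite mulr0 -cleared_sumZ.
  rewrite -[RHS](cleared_sum_root z m M zn ltM).
  apply: eq_cleared_sum => j /=; rewrite wz_deform_horner /wz_factor /b.
  by field.
- rewrite map_inj_in_uniq ?iota_uniq // => M1 M2.
  rewrite !mem_iota => /andP[_ lt1] /andP[_ lt2]; exact: root_param_inj zn lt1 lt2.
- by rewrite size_map size_iota size_cleared_sum // => j; apply: size_wz_deform.
Qed.

(** The sum of (-1)^k (1 - q^(3k+1)) ((q;q^2)_k / (q;q)_k)^3 over k <= m, minus
    (-1)^m q^(m^2) (1 - q^(2m+1)), the whole multiplied by (q;q)_m^3. *)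
Definition half_defect {R : comNzRingType} (q : R) (m : nat) : R :=
  cleared_sum q (fun j => (1 - q ^+ j) ^+ 3) m
  - (-1) ^+ m * q ^+ (m ^ 2) * (1 - q ^+ (2 * m + 1))
    * \prod_(0 <= j < m) (1 - q ^+ j.+1) ^+ 3.

Lemma PhiC_cube_half_defect m : PhiC (2 * m + 1) ^+ 3 %| half_defect ('X : {poly algC}) m.
Proof.
set n := (2 * m + 1)%N; have n0 : (0 < n)%N by rewrite /n addn1.
set x : {poly algC} := 'X.
(* [h] is a polynomial in b with coefficients in C[q]; up to a power of q, its
   value at 0 is the polynomial of the statement. *)
pose D j := wz_deform x (x ^+ n) j.
pose h := cleared_sum x%:P D m
  - ((-1) ^+ m * x ^+ (m ^ 2) * (1 - x ^+ n))%:P * \prod_(0 <= j < m) D j.+1.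
have hv : h.[(1 - x ^+ n) ^+ 2] = 0.
  rewrite -[LHS]/(horner_eval _ h) rmorphB rmorphM cleared_sum_morph rmorph_prod.
  rewrite /= /horner_eval !hornerC.
  have eD j : (D j).[(1 - x ^+ n) ^+ 2] = wz_factor x (x ^+ n) j.
    by rewrite wz_deform_horner /wz_factor; ring.
  rewrite (eq_cleared_sum eD) cleared_sum_poly //.
  by under [in X in _ - X]eq_bigr do rewrite eD; rewrite subrr.
have h0 : h.[0] = x ^+ n ^+ m * half_defect x m.
  rewrite -[LHS]/(horner_eval _ h) rmorphB rmorphM cleared_sum_morph rmorph_prod.
  rewrite /= /horner_eval !hornerC /half_defect (mulrBr (x ^+ n ^+ m)) -cleared_sumZ.
  have eD j : (D j).[0] = x ^+ n * (1 - x ^+ j) ^+ 3.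
    by rewrite wz_deform_horner; ring.
  rewrite (eq_cleared_sum eD); congr (_ - _).
  under eq_bigr do rewrite eD.
  by rewrite big_split /= prodr_const_nat subn0 mulrCA.
have Phi_h i : PhiC n %| h`_i.
  apply: PhiC_dvd => // z zn; rewrite /root -[_.[z]]/(horner_eval z _).
  rewrite -(coef_map (horner_eval z) h i).
  rewrite rmorphB rmorphM cleared_sum_morph rmorph_prod /= !map_polyC /=.
  rewrite /horner_eval !hornerE (prim_expr_order zn) subrr mulr0 mul0r subr0.
  have eD j : map_poly (horner_eval z) (D j) = wz_deform z 1 j.
    rewrite /D /wz_deform rmorphB /= map_polyC [X in _ - X]rmorphM /= map_polyC.
    rewrite map_polyX /= /horner_eval.
    by rewrite !hornerE (prim_expr_order zn) mulr1.
  by rewrite (eq_cleared_sum eD) cleared_sum_deform // coef0.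
(* With h = Phi_N g, the value of [g] at 0 is divisible by (1 - q^N)^2, since
   that is a root of [g]. *)
pose g := \poly_(i < size h) (h`_i %/ PhiC n).
have hg : h = (PhiC n)%:P * g.
  apply/polyP => i; rewrite coefCM coef_poly.
  case: ltnP => [_|le]; first by rewrite mulrC divpK.
  by rewrite mulr0 nth_default.
have Phi0 : PhiC n != 0 by rewrite monic_neq0 // monic_map ?Cyclotomic_monic.
have gv : root g ((1 - x ^+ n) ^+ 2).
  apply/rootP; apply: (mulfI Phi0); rewrite mulr0 -hv hg.
  by rewrite hornerM hornerC.
have [k gk] := factor_theorem _ _ gv.
have Phi_n : PhiC n %| 1 - x ^+ n.
  apply: PhiC_dvd => // z zn.
  by rewrite /root !hornerE (prim_expr_order zn) subrr.
have: PhiC n ^+ 3 %| h.[0].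
  rewrite hg hornerM hornerC gk hornerM exprS dvdp_mul //.
  by rewrite dvdp_mull // hornerXsubC sub0r dvdpNr dvdp_exp2r.
rewrite h0 Gauss_dvdpr // -exprM; apply/coprimep_expl/coprimep_expr.
apply/Pdiv.ClosedField.coprimepP => z; rewrite root_PhiC // hornerX.
exact: prim_root_neq0.
Qed.

(** * Gaussian binomial coefficients *)

(** The Gaussian binomial coefficient, defined by the q-Pascal recurrence, so
    that it is visibly a polynomial with integer coefficients. *)
Fixpoint gauss_binom (n k : nat) : {poly int} :=
  match n, k with
  | _, 0 => 1
  | 0, _.+1 => 0
  | n1.+1, k1.+1 => gauss_binom n1 k1.+1 * 'X ^+ k1.+1 + gauss_binom n1 k1
  end.

(** The products (q;q)_n, (q;q^2)_n and (-q;q)_n. *)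
Definition qpoch {R : pzRingType} (q : R) (n : nat) : R :=
  \prod_(0 <= j < n) (1 - q ^+ j.+1).

Definition qpoch_odd {R : pzRingType} (q : R) (n : nat) : R :=
  \prod_(0 <= j < n) (1 - q ^+ (2 * j + 1)).

Definition qpoch_neg {R : pzRingType} (q : R) (n : nat) : R :=
  \prod_(0 <= j < n) (1 + q ^+ j.+1).

Lemma qpoch0 (R : pzRingType) (q : R) : qpoch q 0 = 1.
Proof. by rewrite /qpoch big_geq. Qed.

Lemma qpochS (R : pzRingType) (q : R) n : qpoch q n.+1 = qpoch q n * (1 - q ^+ n.+1).
Proof. by rewrite /qpoch big_nat_recr. Qed.

Lemma qpoch_morph (R S : pzRingType) (f : {rmorphism R -> S}) q n :
  f (qpoch q n) = qpoch (f q) n.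
Proof.
by rewrite rmorph_prod; apply: eq_bigr => i _; rewrite rmorphB rmorph1 rmorphXn.
Qed.

Lemma qpoch_odd_morph (R S : pzRingType) (f : {rmorphism R -> S}) q n :
  f (qpoch_odd q n) = qpoch_odd (f q) n.
Proof.
by rewrite rmorph_prod; apply: eq_bigr => i _; rewrite rmorphB rmorph1 rmorphXn.
Qed.

Lemma qpoch_neg_morph (R S : pzRingType) (f : {rmorphism R -> S}) q n :
  f (qpoch_neg q n) = qpoch_neg (f q) n.
Proof.
by rewrite rmorph_prod; apply: eq_bigr => i _; rewrite rmorphD rmorph1 rmorphXn.
Qed.

Lemma gauss_binom_small n k : (n < k)%N -> gauss_binom n k = 0.
Proof.
elim: n k => [|n IH] [|k] //= lt.
by rewrite !IH ?mul0r ?add0r // ltnW.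
Qed.

Lemma gauss_binom0 n : gauss_binom n 0 = 1.
Proof. by case: n. Qed.

Lemma gauss_binom_qpoch i j :
  gauss_binom (i + j) i * qpoch 'X i * qpoch 'X j = qpoch 'X (i + j).
Proof.
elim: i j => [|i IHi] j.
  by rewrite add0n gauss_binom0 qpoch0 !mul1r.
elim: j => [|j IHj].
  rewrite addn0 /= gauss_binom_small // mul0r add0r.
  have := IHi 0%N; rewrite addn0 qpoch0 !mulr1 => e0.
  by rewrite qpochS -[in RHS]e0; ring.
have e1 := IHi j.+1; rewrite addSnnS in IHj.
rewrite addSn /= (qpochS _ _ (i + j.+1)).
have -> : ((i + j.+1).+1 = i.+1 + j.+1)%N by [].
rewrite exprD.
transitivity (qpoch 'X (i + j.+1) * (1 - 'X ^+ i.+1)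
  + 'X ^+ i.+1 * (qpoch 'X (i + j.+1) * (1 - 'X ^+ j.+1)) : {poly int}); last by ring.
rewrite -{1}e1 -IHj !qpochS; ring.
Qed.

Lemma gauss_binom_horner1 n k : (gauss_binom n k).[1] = 'C(n, k)%:R.
Proof.
elim: n k => [|n IH] [|k] /=; rewrite ?hornerC ?bin0 //.
by rewrite binS !hornerE !IH expr1n mulr1 natrD.
Qed.

Lemma one_subXn_neq0 (R : nzRingType) n : (1 - 'X ^+ n.+1 : {poly R}) != 0.
Proof. by rewrite -opprB oppr_eq0 monic_neq0 // monicXnsubC. Qed.

Lemma qpoch_neq0 n : qpoch ('X : {poly int}) n != 0.
Proof.
by rewrite /qpoch prodf_seq_neq0; apply/allP => j _; apply/implyP; rewrite one_subXn_neq0.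
Qed.

Lemma qpoch_double (R : comPzRingType) (q : R) k :
  qpoch q (2 * k) = qpoch_odd q k * (qpoch q k * qpoch_neg q k).
Proof.
elim: k => [|k IH]; first by rewrite /qpoch /qpoch_odd /qpoch_neg !big_geq // !mulr1.
rewrite mulnS !qpochS {}IH /qpoch_odd /qpoch_neg !(big_nat_recr k) //=.
rewrite addn1 (_ : (2 * k).+2 = k.+1 + k.+1)%N; last by lia.
rewrite exprD; ring.
Qed.

(** The q-analogue of the central binomial coefficient. *)
Definition central_gauss (k : nat) : {poly int} := gauss_binom (2 * k) k.

Lemma central_gauss_qpoch k :
  central_gauss k * qpoch 'X k = qpoch_odd 'X k * qpoch_neg 'X k.
Proof.
apply: (mulIf (qpoch_neq0 k)); have := gauss_binom_qpoch k k.
by rewrite addnn -mul2n qpoch_double => e; rewrite [LHS]e; ring.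
Qed.

Lemma central_gaussS k :
  central_gauss k.+1 * (1 - 'X ^+ k.+1)
  = central_gauss k * (1 - 'X ^+ (2 * k + 1)) * (1 + 'X ^+ k.+1).
Proof.
apply: (mulIf (qpoch_neq0 k)); have := central_gauss_qpoch k.+1.
rewrite qpochS mulrA mulrAC => ->; rewrite /qpoch_odd /qpoch_neg !(big_nat_recr k) //=.
rewrite -/(qpoch_odd _ _) -/(qpoch_neg _ _).
transitivity (qpoch_odd 'X k * qpoch_neg 'X k * ((1 - 'X ^+ (2 * k + 1)) * (1 + 'X ^+ k.+1))
  : {poly int}); first by ring.
rewrite -central_gauss_qpoch; ring.
Qed.

Lemma central_gauss_horner1 k : (central_gauss k).[1] = 'C(2 * k, k)%:R.
Proof. exact: gauss_binom_horner1. Qed.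

Lemma central_gauss0 : central_gauss 0 = 1.
Proof. exact: gauss_binom0. Qed.

(** * The full sum at roots of unity *)

(** The q-integer 1 + q + ... + q^(n-1). *)
Definition qint (n : nat) : {poly int} := \sum_(i < n) 'X ^+ i.

Lemma qintE n : (1 - 'X) * qint n = 1 - 'X ^+ n.
Proof. by rewrite -[RHS]opprB subrX1 -mulNr opprB. Qed.

(** The difference of the two sides of the q-congruence for N = 2m + 1,
    multiplied by ((1 + q) ... (1 + q^(2m)))^3. *)
Definition full_defect (m : nat) : {poly int} :=
  \sum_(0 <= k < (2 * m).+1) (-1) ^+ k * qint (3 * k + 1) * central_gauss k ^+ 3
     * (\prod_(k <= j < 2 * m) (1 + 'X ^+ j.+1)) ^+ 3
  - (-1) ^+ m * 'X ^+ (m ^ 2) * qint (2 * m + 1) * qpoch_neg 'X (2 * m) ^+ 3.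

(** In this section the indeterminate q is evaluated at a primitive d-th root
    of unity [z], with d odd. *)
Section AtRoot.
Variables (f : {rmorphism {poly int} -> algC}) (e : nat).
Let z := f 'X.
Let d := (2 * e + 1)%N.
Hypothesis zd : d.-primitive_root z.

(** The value at [z] of the quotient (q;q^2)_k / (q;q)_k, which is regular
    there. *)
Definition root_ratio (k : nat) : algC := f (central_gauss k) / qpoch_neg z k.

Lemma root_expD1_neq0 j : 1 + z ^+ j != 0.
Proof using zd.
rewrite addrC addr_eq0; apply/eqP => zj.
have: (z ^+ j) ^+ d = 1 by rewrite exprAC (prim_expr_order zd) expr1n.
rewrite zj /d addn1 exprS mul2n -muln2 exprM sqrr_sign mulr1 => /eqP.
by rewrite eq_sym -addr_eq0 -(natrD _ 1 1) pnatr_eq0.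
Qed.

Lemma qpoch_neg_root_neq0 k : qpoch_neg z k != 0.
Proof using zd.
rewrite /qpoch_neg prodf_seq_neq0; apply/allP => j _; apply/implyP => _.
exact: root_expD1_neq0.
Qed.

Lemma root_exp1B_neq0 j : ~~ (d %| j)%N -> 1 - z ^+ j != 0.
Proof using zd. by rewrite (prim_order_dvd zd) subr_eq0 eq_sym. Qed.

Lemma qpoch_root_neq0 k : (k < d)%N -> qpoch z k != 0.
Proof using zd.
move=> lt; rewrite /qpoch prodf_seq_neq0; apply/allP => j.
rewrite mem_index_iota => /andP[_ ltj]; apply/implyP => _.
by rewrite root_exp1B_neq0 // gtnNdvd // (leq_ltn_trans ltj lt).
Qed.

Lemma root_ratio0 : root_ratio 0 = 1.
Proof.
by rewrite /root_ratio central_gauss0 rmorph1 /qpoch_neg big_geq ?divr1.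
Qed.

Lemma root_ratioS k :
  root_ratio k.+1 * (1 - z ^+ k.+1) = root_ratio k * (1 - z ^+ (2 * k + 1)).
Proof using zd.
rewrite /root_ratio; move: (central_gaussS k).
move: (central_gauss k.+1) (central_gauss k) => c1 c0 /(congr1 f).
rewrite !rmorphM !rmorphB !rmorphD !rmorph1 !rmorphXn -/z => E.
rewrite mulrAC E /qpoch_neg big_nat_recr //= -/(qpoch_neg z k).
have h1 := root_expD1_neq0 k.+1; have h2 := qpoch_neg_root_neq0 k.
by field; rewrite h2 h1.
Qed.

Lemma root_ratio_qpoch k : root_ratio k * qpoch z k = qpoch_odd z k.
Proof using zd.
rewrite /root_ratio; move: (central_gauss_qpoch k).
move: (central_gauss k) => c /(congr1 f).
rewrite !rmorphM !qpoch_morph qpoch_odd_morph qpoch_neg_morph -/z => E.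
by rewrite mulrAC E mulfK // qpoch_neg_root_neq0.
Qed.

(** A q-Lucas property: the recurrence [root_ratioS] is periodic in k, of
    period d. *)
Lemma root_ratioD l i : (i < d)%N ->
  root_ratio (l * d + i) = root_ratio (l * d) * root_ratio i.
Proof using zd.
elim: i => [|i IH] lt; first by rewrite addn0 root_ratio0 mulr1.
have zl k : z ^+ (l * d + k) = z ^+ k.
  by rewrite exprD mulnC exprM (prim_expr_order zd) expr1n mul1r.
apply: (mulIf (root_exp1B_neq0 i.+1 _)); first by rewrite gtnNdvd.
rewrite -{1}(zl i.+1) addnS.
rewrite root_ratioS IH ?(ltnW lt) // -[RHS]mulrA root_ratioS.
rewrite [RHS]mulrA; congr (_ * (1 - _)).
have -> : (2 * (l * d + i) + 1 = 2 * l * d + (2 * i + 1))%N by lia.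
by rewrite exprD mulnC exprM (prim_expr_order zd) expr1n mul1r.
Qed.

Lemma root_ratio_eq0 i : (e < i < d)%N -> root_ratio i = 0.
Proof using zd.
move=> /andP[lei lid]; apply: (mulIf (qpoch_root_neq0 i lid)).
rewrite mul0r root_ratio_qpoch /qpoch_odd (bigD1_seq e) ?mem_index_iota ?iota_uniq //=.
by rewrite (prim_expr_order zd) subrr mul0r.
Qed.

(** The value at [z] of the k-th term of the sum, multiplied by 1 - z. *)
Definition root_term k := (-1) ^+ k * (1 - z ^+ (3 * k + 1)) * root_ratio k ^+ 3.

Lemma sum_root_term_block : \sum_(0 <= i < d) root_term i = 0.
Proof using zd.
rewrite (big_cat_nat (n := e.+1)) //=; last by rewrite /d; lia.
rewrite [X in _ + X]big1_seq ?addr0; last first.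
  move=> i; rewrite mem_index_iota => /andP[_ h].
  by rewrite /root_term root_ratio_eq0 // expr0n mulr0.
have lt_ed : (e < d)%N by rewrite /d; lia.
apply: (mulfI (expf_neq0 3 (qpoch_root_neq0 e lt_ed))); rewrite mulr0.
rewrite -[RHS](cleared_sum_root z e e zd (leqnn e)) big_mkord mulr_sumr.
apply: eq_bigr => k _; have lek : (k <= e)%N by rewrite -ltnS.
have ew j : wz_factor z (z ^+ (2 * e + 1)) j = (1 - z ^+ j) ^+ 3.
  by rewrite (prim_expr_order zd) /wz_factor; ring.
under [X in _ = _ * (X * _)]eq_bigr do rewrite ew.
under [X in _ = _ * (_ * X)]eq_bigr do rewrite ew.
rewrite -(big_mkord xpredT (fun i => (1 - z ^+ (2 * i + 1)) ^+ 3)).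
rewrite !prodrXl -/(qpoch_odd z k) -root_ratio_qpoch.
rewrite /qpoch (big_cat_nat (m := 0) (n := k) (p := e)) //= /root_term.
ring.
Qed.

Lemma sum_root_term t : \sum_(0 <= k < t * d) root_term k = 0.
Proof using zd.
elim: t => [|t IH]; first by rewrite big_geq.
rewrite (big_cat_nat (n := (t * d)%N)) //=; last by rewrite leq_mul2r leqnSn orbT.
rewrite IH add0r -{1}[(t * d)%N]add0n mulSn big_addn addnK.
rewrite (eq_big_seq (fun i => (-1) ^+ (t * d) * root_ratio (t * d) ^+ 3 * root_term i)).
  by rewrite -mulr_sumr sum_root_term_block mulr0.
move=> i; rewrite mem_index_iota => /andP[_ lt].
rewrite /root_term addnC root_ratioD // exprD.
have -> : (3 * (t * d + i) + 1 = 3 * t * d + (3 * i + 1))%N by lia.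
have -> : z ^+ (3 * t * d + (3 * i + 1)) = z ^+ (3 * i + 1).
  by rewrite exprD mulnC exprM (prim_expr_order zd) expr1n mul1r.
ring.
Qed.

(** Vanishing at the primitive d-th roots of unity, for every d > 1 dividing N. *)
Lemma full_defect_root m :
  (1 < d)%N -> (d %| 2 * m + 1)%N -> f (full_defect m) = 0.
Proof using zd.
move=> d1 dvd_dm; have zn : z ^+ (2 * m + 1) = 1.
  by apply/eqP; rewrite -(prim_order_dvd zd).
have z1 : 1 - z != 0.
  by have := root_exp1B_neq0 1; rewrite expr1; apply; rewrite gtnNdvd.
have f_qint k : (1 - z) * f (qint k) = 1 - z ^+ k.
  by rewrite -(rmorphXn f) -(rmorph1 f) -!(rmorphB f) -(rmorphM f) qintE.
have qint0 : f (qint (2 * m + 1)) = 0.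
  by apply: (mulfI z1); rewrite f_qint zn subrr mulr0.
apply: (mulfI z1); rewrite mulr0 rmorphB mulrBr !(rmorphM f) qint0 !(mulr0, mul0r) subr0.
have e0 := sum_root_term ((2 * m + 1) %/ d); rewrite divnK // addn1 in e0.
rewrite -[RHS](mulr0 (qpoch_neg z (2 * m) ^+ 3)) -e0 rmorph_sum !mulr_sumr.
rewrite !big_mkord; apply: eq_bigr => k _.
have lek : (k <= 2 * m)%N by rewrite -ltnS.
rewrite /root_term -(f_qint (3 * k + 1)%N) /root_ratio.
move: (central_gauss k) (qint _) => c1 c2.
rewrite !rmorphM !rmorphXn rmorph_prod rmorphN1.
under eq_bigr do rewrite rmorphD rmorph1 rmorphXn -/z.
rewrite {1}/qpoch_neg (big_cat_nat (m := 0) (n := k) (p := 2 * m)) //= -/(qpoch_neg z k).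
have h := qpoch_neg_root_neq0 k.
by field.
Qed.

End AtRoot.

(** The embedding of Z[q] in the polynomials over the algebraic numbers. *)
Definition intC : {rmorphism {poly int} -> {poly algC}} := map_poly intr.

Lemma intC_X : intC 'X = 'X.
Proof. exact: map_polyX. Qed.

Lemma intC_qint n : (1 - 'X) * intC (qint n) = 1 - 'X ^+ n.
Proof.
by rewrite -intC_X -(rmorph1 intC) -(rmorphXn intC) -!(rmorphB intC) -(rmorphM intC) qintE.
Qed.

Lemma qpoch_PhiC_coprime n k : (0 < n)%N -> (k < n)%N ->
  coprimep (PhiC n) (qpoch 'X k).
Proof.
move=> n0 ltk; apply/Pdiv.ClosedField.coprimepP => z; rewrite root_PhiC // => zn.
rewrite -[_.[z]]/(horner_eval z _) qpoch_morph /= /horner_eval hornerX.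
rewrite /qpoch prodf_seq_neq0; apply/allP => j.
rewrite mem_index_iota => /andP[_ ltj]; apply/implyP => _.
rewrite subr_eq0 eq_sym -(prim_order_dvd zn) gtnNdvd //.
exact: leq_ltn_trans ltk.
Qed.

Lemma PhiC_dvd_central_gauss m k : (m < k < 2 * m + 1)%N ->
  PhiC (2 * m + 1) %| intC (central_gauss k).
Proof.
move=> /andP[lmk lkn]; have n0 : (0 < 2 * m + 1)%N by rewrite addn1.
rewrite -(Gauss_dvdpl _ (qpoch_PhiC_coprime _ k n0 lkn)).
rewrite -intC_X -qpoch_morph -(rmorphM intC) central_gauss_qpoch rmorphM.
apply: dvdp_mulr; rewrite qpoch_odd_morph intC_X; apply: PhiC_dvd => // z zn.
rewrite /qpoch_odd (bigD1_seq m) ?mem_index_iota ?iota_uniq //= rootM.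
by rewrite /root !hornerE (prim_expr_order zn) subrr eqxx.
Qed.

Lemma PhiC_cube_full_defect m : (0 < m)%N ->
  PhiC (2 * m + 1) ^+ 3 %| intC (full_defect m).
Proof.
move=> m0; set n := (2 * m + 1)%N; have n0 : (0 < n)%N by rewrite /n addn1.
have lt_mn : (m < n)%N by rewrite /n; lia.
(* Multiplying by a polynomial prime to Phi_N turns the terms with k <= m into
   those of [half_defect], up to the factor ((1 + q) ... (1 + q^(2m)))^3. *)
have cop : coprimep (PhiC n ^+ 3) ((1 - 'X) * qpoch 'X m ^+ 3).
  apply: coprimep_expl; rewrite coprimepMr.
  rewrite coprimep_expr ?qpoch_PhiC_coprime // andbT.
  have := qpoch_PhiC_coprime n 1 n0; rewrite /qpoch big_nat1 expr1; apply.
  by rewrite /n; lia.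
rewrite -(Gauss_dvdpr _ cop).
pose t k := intC ((-1) ^+ k * qint (3 * k + 1) * central_gauss k ^+ 3
     * (\prod_(k <= j < 2 * m) (1 + 'X ^+ j.+1)) ^+ 3).
pose r := intC ((-1) ^+ m * 'X ^+ (m ^ 2) * qint (2 * m + 1) * qpoch_neg 'X (2 * m) ^+ 3).
have -> : intC (full_defect m) = \sum_(m.+1 <= k < (2 * m).+1) t k
    + (\sum_(0 <= k < m.+1) t k - r).
  rewrite rmorphB rmorph_sum (big_cat_nat (n := m.+1)) //=; last by lia.
  by rewrite addrA [X in X - _]addrC.
rewrite mulrDr dvdp_add //.
  apply: dvdp_mull; rewrite big_seq; apply: (big_ind (fun p => PhiC n ^+ 3 %| p)).
  - exact: dvdp0.
  - by move=> p1 p2; apply: dvdp_add.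
  move=> k; rewrite mem_index_iota => hk; rewrite /t !(rmorphM intC) (rmorphXn intC).
  apply: dvdp_mulr; apply: dvdp_mull; apply: dvdp_exp2r.
  by apply: PhiC_dvd_central_gauss; lia.
suff -> : (1 - 'X) * qpoch 'X m ^+ 3 * (\sum_(0 <= k < m.+1) t k - r)
    = qpoch_neg 'X (2 * m) ^+ 3 * half_defect ('X : {poly algC}) m.
  by apply: dvdp_mull; apply: PhiC_cube_half_defect.
rewrite /half_defect (mulrBr ((1 - 'X) * qpoch 'X m ^+ 3)) (mulrBr (qpoch_neg 'X (2 * m) ^+ 3)).
congr (_ - _); last first.
  rewrite /r !(rmorphM intC) !(rmorphXn intC) (rmorphN1 intC) qpoch_neg_morph intC_X.
  rewrite prodrXl -/(qpoch _ m) -intC_qint; ring.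
rewrite big_mkord !mulr_sumr; apply: eq_bigr => k _.
have lek : (k <= m)%N by rewrite -ltnS.
rewrite -(big_mkord xpredT (fun i => (1 - 'X ^+ (2 * i + 1)) ^+ 3)) !prodrXl.
rewrite -/(qpoch_odd _ k) -intC_qint /t.
have := congr1 intC (central_gauss_qpoch k).
rewrite [in LHS](rmorphM intC) [in RHS](rmorphM intC).
rewrite qpoch_morph qpoch_odd_morph qpoch_neg_morph intC_X.
move: (central_gauss k) (qint _) => c1 c2 E.
rewrite !(rmorphM intC) !(rmorphXn intC) (rmorphN1 intC) rmorph_prod.
under eq_bigr do rewrite rmorphD rmorph1 rmorphXn intC_X.
rewrite /qpoch (big_cat_nat (m := 0) (n := k) (p := m)) //= -/(qpoch _ k).
rewrite [qpoch_neg _ (2 * m)]/qpoch_neg (big_cat_nat (m := 0) (n := k) (p := 2 * m)) //=;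
  last by lia.
rewrite -/(qpoch_neg _ k).
set A := \prod_(k <= i < m) _; set B := \prod_(k <= i < 2 * m) _.
transitivity ((1 - 'X) * (-1) ^+ k * intC c2 * (intC c1 * qpoch 'X k) ^+ 3 * A ^+ 3 * B ^+ 3).
  by ring.
rewrite E; ring.
Qed.

(** * Prime powers and the value at 1 *)

Lemma Cyclotomic_pfactor (p r : nat) : prime p ->
  'Phi_(p ^ r.+1) = \sum_(i < p) ('X ^+ (p ^ r)) ^+ i.
Proof.
move=> pr_p; have p0 : (0 < p)%N by apply: prime_gt0.
have pr0 s : (0 < p ^ s)%N by rewrite expn_gt0 p0.
have q0 : ('X^(p ^ r) - 1 : {poly int}) != 0 by rewrite monic_neq0 // monicXnsubC.
apply: (mulfI q0); rewrite -subrX1 -exprM -expnSr.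
have div_pr : perm_eq (divisors (p ^ r.+1)) (p ^ r.+1 :: divisors (p ^ r))%N.
  apply: uniq_perm; rewrite ?divisors_uniq //=.
    rewrite divisors_uniq andbT -dvdn_divisors // gtnNdvd //.
    by rewrite ltn_exp2l // prime_gt1.
  move=> d; rewrite in_cons -!dvdn_divisors //.
  apply/(dvdn_pfactor _ _ pr_p)/idP => [[s les ->]|].
    have [->|ne] := eqVneq s r.+1; first by rewrite eqxx.
    by rewrite dvdn_exp2l ?orbT //; lia.
  case/predU1P => [->|/(dvdn_pfactor _ _ pr_p)[s les ->]]; first by exists r.+1.
  by exists s => //; apply: leqW.
by rewrite -!prod_Cyclotomic // (perm_big _ div_pr) big_cons mulrC.
Qed.

Lemma qint_pfactor (p r : nat) : prime p ->
  qint (p ^ r.+1) = qint (p ^ r) * 'Phi_(p ^ r.+1).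
Proof.
move=> pr_p; have X1 : (1 - 'X : {poly int}) != 0.
  by have := one_subXn_neq0 int 0; rewrite expr1.
apply: (mulfI X1); rewrite mulrA !qintE Cyclotomic_pfactor //.
rewrite expnSr exprM -opprB subrX1 -mulNr opprB; congr (_ * _).
Qed.

Lemma qint_horner1 n : (qint n).[1] = n%:R.
Proof.
rewrite /qint horner_sum (eq_bigr (fun _ => 1)) ?sumr_const ?card_ord // => i _.
by rewrite hornerXn expr1n.
Qed.

Lemma Cyclotomic_pfactor_horner1 (p r : nat) : prime p -> ('Phi_(p ^ r.+1)).[1] = p%:R.
Proof.
move=> pr_p; rewrite Cyclotomic_pfactor // horner_sum.
rewrite (eq_bigr (fun _ => 1)) ?sumr_const ?card_ord // => i _.
by rewrite -exprM hornerXn expr1n.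
Qed.

Lemma monic_qint n : (0 < n)%N -> qint n \is monic.
Proof.
move=> n0; have mX : ('X - 1 : {poly int}) \is monic by apply: monicXsubC.
rewrite -(monicMl _ mX) -opprB mulNr qintE opprB; exact: monicXnsubC.
Qed.

Lemma separable_intC_qint n : (0 < n)%N -> separable_poly (intC (qint n)).
Proof.
move=> n0; have: separable_poly ('X^n - 1 : {poly algC}).
  by rewrite separable_Xn_sub_1 // pnatr_eq0 -lt0n.
by apply: dvdp_separable; rewrite -opprB -intC_qint -mulNr dvdp_mull.
Qed.

Lemma root_intC_qint {n} {z : algC} : (0 < n)%N ->
  root (intC (qint n)) z -> z ^+ n = 1 /\ z != 1.
Proof.
move=> n0 /rootP z0; split.
  have := congr1 (fun u : {poly algC} => u.[z]) (intC_qint n).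
  by rewrite hornerM z0 mulr0 !hornerE => /eqP; rewrite eq_sym subr_eq0 => /eqP.
apply: contra_eqN z0 => /eqP ->.
rewrite -[1]/(1%:~R) /intC /= horner_map /= qint_horner1.
by rewrite rmorph_nat pnatr_eq0 -lt0n.
Qed.

(** Divisibility by a monic integer polynomial descends to Z[q]. *)
Lemma monic_dvdp_intC (g h : {poly int}) :
  g \is monic -> intC g %| intC h -> exists k, h = k * g.
Proof.
move=> mg gh; have e := Pdiv.RingMonic.rdivp_eq mg h.
exists (Pdiv.Ring.rdivp h g); rewrite {1}e.
suff -> : Pdiv.Ring.rmodp h g = 0 by rewrite addr0.
set r := Pdiv.Ring.rmodp h g in e *.
have inj_intC : injective intC by apply: map_inj_poly => //; apply: intr_inj.
have size_intC q : size (intC q) = size q.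
  by rewrite size_map_inj_poly //; apply: intr_inj.
have gr : intC g %| intC r.
  by move: gh; rewrite e rmorphD rmorphM dvdp_addr // dvdp_mull.
apply: inj_intC; rewrite rmorph0; apply/eqP; apply: contraTT gr => r0.
apply/negP => /(dvdp_leq r0); rewrite !size_intC leqNgt.
by rewrite Pdiv.Ring.ltn_rmodp monic_neq0.
Qed.

Lemma full_defect_dvd (p r m : nat) : prime p -> (2 * m + 1 = p ^ r.+1)%N ->
  exists k, full_defect m = k * (qint (p ^ r.+1) * 'Phi_(p ^ r.+1) ^+ 2).
Proof.
move=> pr_p Nm.
have p0 : (0 < p)%N by apply: prime_gt0.
have pr0 s : (0 < p ^ s)%N by rewrite expn_gt0 p0.
have m0 : (0 < m)%N.
  have : (p ^ 0 < 2 * m + 1)%N by rewrite Nm ltn_exp2l // prime_gt1.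
  by rewrite expn0; lia.
apply: monic_dvdp_intC.
  rewrite !rpredM ?rpredX ?Cyclotomic_monic //.
  exact: monic_qint.
(* The divisor is the q-integer of N / p times Phi_N^3, with coprime
   factors.  The first one is separable, and its roots are the roots of unity of
   order d > 1 dividing N / p. *)
rewrite qint_pfactor // -mulrA -exprS (rmorphM intC) (rmorphXn intC).
rewrite Gauss_dvdp; last first.
  apply: coprimep_expr; apply/Pdiv.ClosedField.coprimepP => z /(root_intC_qint (pr0 r))[zr _].
  rewrite -/(root _ _) -/(PhiC _) root_PhiC //.
  apply/negP => zp; have := eqxx (1 : algC); rewrite -{1}zr -(prim_order_dvd zp).
  by rewrite gtnNdvd // ltn_exp2l // prime_gt1.
rewrite -[intC 'Phi_ _]/(PhiC _) -Nm PhiC_cube_full_defect // andbT.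
apply: separable_dvdp.
  exact: separable_intC_qint.
move=> z /(root_intC_qint (pr0 r))[zr z1].
have [d zd dvd_d] := prim_order_exists (pr0 r) zr.
have odd_d : odd d.
  apply: dvdn_odd (dvdn_trans dvd_d (dvdn_exp2l p (leqnSn r))) _.
  by rewrite -Nm addn1 /= mul2n odd_double.
pose e := d./2; have de : d = (2 * e + 1)%N.
  by rewrite -{1}(odd_double_half d) odd_d mul2n addnC.
pose f : {rmorphism {poly int} -> algC} := horner_eval z \o intC.
have fX : f 'X = z by rewrite /f /= intC_X /horner_eval hornerX.
apply/rootP; rewrite -[LHS]/(f _).
apply: (full_defect_root f e); rewrite ?fX -?de //.
  rewrite ltn_neqAle (prim_order_gt0 zd) andbT eq_sym.
  by apply: contraNneq z1 => d1; rewrite -(prim_expr_order zd) d1 expr1.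
by rewrite Nm (dvdn_trans dvd_d) // dvdn_exp2l.
Qed.

(** A fraction with denominator prime to p is p-integral, reduced or not. *)
Lemma p_integral_divn (p d : nat) (c : int) :
  (0 < d)%N -> coprime p d -> p_integral p (c%:~R / d%:R).
Proof.
move=> d0 cop; rewrite /p_integral; apply: coprime_dvdr cop.
set x : rat := _ / _.
have d0Q : (d%:R : rat) != 0 by rewrite pnatr_eq0 -lt0n.
have e : numq x * Posz d = c * denq x.
  apply: (@intr_inj rat); rewrite !intrM numqE mulrAC; congr (_ * _).
  by rewrite -pmulrn /x divfK.
have := coprime_num_den x; rewrite coprime_sym => h.
rewrite -(Gauss_dvdr _ h) -[d]/(absz (Posz d)) -abszM e abszM.
exact: dvdn_mull.
Qed.

Lemma full_defect_horner1 m :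
  (full_defect m).[1]
  = \sum_(0 <= k < (2 * m).+1) (-1) ^+ k * (3 * k + 1)%:R * 'C(2 * k, k)%:R ^+ 3
       * 8%:R ^+ (2 * m - k)
    - (-1) ^+ m * (2 * m + 1)%:R * 8%:R ^+ (2 * m).
Proof.
have two j : (1 + 'X ^+ j.+1 : {poly int}).[1] = 2%:R by rewrite !hornerE expr1n.
rewrite -[LHS]/(horner_eval 1 _) rmorphB rmorph_sum; congr (_ - _).
  apply: eq_bigr => k _.
  rewrite !rmorphM !(rmorphXn (horner_eval 1)) rmorphN1 rmorph_prod.
  rewrite /= /horner_eval qint_horner1 central_gauss_horner1.
  under eq_bigr do rewrite two.
  rewrite prodr_const_nat (_ : 8%:R = 2%:R * (2%:R * 2%:R) :> int) // !exprMn.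
  by rewrite -!mulrA.
rewrite !rmorphM !(rmorphXn (horner_eval 1)) rmorphN1 rmorph_prod.
rewrite /= /horner_eval qint_horner1 hornerX expr1n mulr1.
under eq_bigr do rewrite two.
rewrite prodr_const_nat subn0 (_ : 8%:R = 2%:R * (2%:R * 2%:R) :> int) // !exprMn.
by rewrite -!mulrA.
Qed.

Theorem theorem1p4 (p r : nat) (p_prime : prime p) (p_gt3 : (3 < p)%N)
    (r_gt0 : (0 < r)%N) :
  rat_congr p (r + 2)
    (\sum_(0 <= n < p ^ r)
       (3 * n + 1)%:R / (- 8%:R) ^+ n * 'C(2 * n, n)%:R ^+ 3)
    ((-1) ^+ ((p ^ r - 1) %/ 2) * (p ^ r)%:R).
Proof.
case: r r_gt0 => // r _; set N := (p ^ r.+1)%N.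
have odd_p : odd p by apply: contraTT p_gt3 => /(prime_oddPn p_prime) ->.
have odd_N : odd N by rewrite /N oddX odd_p orbT.
pose m := ((N - 1) %/ 2)%N.
have Nm : (2 * m + 1)%N = N.
  by rewrite /m divn2 subn1 -{2}(odd_double_half N) odd_N; lia.
have [k Ek] := full_defect_dvd p r m p_prime Nm.
have := congr1 (fun u : {poly int} => u.[1]) Ek.
rewrite !hornerM qint_horner1 Cyclotomic_pfactor_horner1 // full_defect_horner1.
move: (k.[1]) => c Ec {k Ek}.
have e8 : (8%:R : rat) != 0 by [].
have p0 : (p%:R : rat) != 0 by rewrite pnatr_eq0 -lt0n prime_gt0.
rewrite /rat_congr -/m.
suff -> : (\sum_(0 <= n < N) (3 * n + 1)%:R / (- 8%:R) ^+ n * 'C(2 * n, n)%:R ^+ 3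
    - (-1) ^+ m * N%:R) / p%:R ^+ (r.+1 + 2) = c%:~R / (8 ^ (2 * m))%:R :> rat.
  apply: p_integral_divn; first by rewrite expn_gt0.
  rewrite (_ : 8 = 2 ^ 3)%N // -expnM coprimeXr //.
  by rewrite coprime_sym coprime2n.
rewrite natrX; apply/eqP; rewrite eqr_div ?expf_neq0 //; apply/eqP.
have -> : c%:~R * p%:R ^+ (r.+1 + 2)
    = (c * (N%:R * (p%:R * p%:R)))%:~R :> rat.
  by rewrite !intrM !rmorph_nat exprD -natrX -/N.
rewrite -Ec rmorphB rmorph_sum mulrBl mulr_suml; congr (_ - _); last first.
  by rewrite !rmorphM !(rmorphXn intr) rmorphN1 !rmorph_nat Nm.
rewrite -Nm addn1; apply: eq_big_seq => n; rewrite mem_index_iota => /andP[_ ltn].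
rewrite !rmorphM !(rmorphXn intr) rmorphN1 !rmorph_nat.
have -> : (- 8%:R : rat) ^+ n = (-1) ^+ n * 8%:R ^+ n by rewrite -exprMn mulN1r.
have -> : (8%:R : rat) ^+ (2 * m) = 8%:R ^+ n * 8%:R ^+ (2 * m - n).
  by rewrite -exprD subnKC // -ltnS.
rewrite invfM -exprVn invrN1.
have := expf_neq0 n e8; move: ((-1) ^+ n) (8%:R ^+ n) => s t t0.
by field.
Qed.
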